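(* The Large-or-Small algorithm ($LS$) is at least $\frac12\left(1-\frac1e\right)$-competitive: for every problem instance and every optimal solution $x^*$ of the linear program (LP) of the context used by $LS$, $$\mathbf{E}[\mathrm{LS}(I)]\ \ge\ \frac12\left(1-\frac1e\right)\mathbf{E}[\mathrm{OPT}(I)],$$ where $\mathrm{LS}(I)$ is the total amount of resources allocated by $LS$ on the sample path $I$.
   Context: Model. Write $[k]=\{1,\dots,k\}$. A problem instance consists of a horizon $[0,T]$; $m$ resources, resource $j\in[m]$ having capacity $c_j>0$; $n$ customer types, where customers of type $i\in[n]$ arrive according to a non-homogeneous Poisson process with known rate $\lambda_i(t)$, $t\in[0,T]$, and finite expected number of arrivals $\Lambda_i=\int_0^T\lambda_i(t)\,dt$ (the processes of different types are independent); and known numbers $u_{ij}\in[0,c_j]$. When a customer arrives, it must immediately and irrevocably be assigned to one of the resources or rejected. Assigning a type-$i$ customer to resource $j$ consumes exactly $u_{ij}$ units of resource $j$ (allowed only if at least $u_{ij}$ units of $j$ remain) and earns reward $u_{ij}$. $I$ denotes a sample path of arrivals over the whole horizon, and $\mathrm{OPT}(I)$ is the total amount of resources allocated by an optimal offline algorithm, i.e. one that knows $I$ at time $0$. Expectations are over $I$ and the algorithm's randomness. An online algorithm $ALG$ is $\alpha$-competitive if $\mathbf{E}[\mathrm{ALG}(I)]\ge\alpha\,\mathbf{E}[\mathrm{OPT}(I)]$ for every instance. (LP): maximize $\sum_{i\in[n]}\sum_{j\in[m]}x_{ij}u_{ij}$ subject to $\sum_{i}x_{ij}u_{ij}\le c_j$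 for all $j$, $\sum_j x_{ij}\le\Lambda_i$ for all $i$, and $x_{ij}\ge0$. Algorithm $LS$. For each resource $j$ let $L_j=\{i\in[n]:u_{ij}>c_j/2\}$ and $S_j=[n]\setminus L_j$. (1) Solve (LP) to get an optimal solution $x^*$; set $U_j^L=\sum_{i\in L_j}x^*_{ij}u_{ij}$, $U_j^S=\sum_{i\in S_j}x^*_{ij}u_{ij}$. (2) Reservation: reserve resource $j$ for the types in $L_j$ if $U_j^L\ge U_j^S$, and for the types in $S_j$ otherwise. (3) Random routing: upon arrival of a type-$i$ customer, independently of everything else, pick at random a resource, resource $j$ being picked with probability $x^*_{ij}/\Lambda_i$ (with the remaining probability none is picked and the customer is rejected). (4) Admission: if the remaining capacity of the picked resource $j$ is at least $u_{ij}$ and $i$ belongs to the set reserved for $j$, assign the customer to $j$; otherwise reject the customer. *)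

(* Defs.v *)
(* MathComp-Analysis world. *)
From HB Require Import structures.
From mathcomp Require Import all_boot all_order all_algebra.
From mathcomp Require Import all_classical all_reals all_analysis.

Set Implicit Arguments.
Unset Strict Implicit.
Unset Printing Implicit Defensive.

Import Order.TTheory GRing.Theory Num.Theory.
Import numFieldNormedType.Exports.

Local Open Scope classical_set_scope.
Local Open Scope ring_scope.

Record instance (R : realType) (n m : nat) := Instance {
  horizon : R;
  capacity : 'I_m -> R;
  rate : 'I_n -> R -> R;
  usage : 'I_n -> 'I_m -> R;
  horizon_ge0 : 0 <= horizon;
  capacity_gt0 : forall j, 0 < capacity j;
  rate_ge0 : forall i t, 0 <= t <= horizon -> 0 <= rate i t;
  rate_integrable : forall i,
    lebesgue_measure.-integrable `[0, horizon] (EFin \o rate i);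
  usage_bounds : forall i j, 0 <= usage i j <= capacity j }.

Definition mean_arrivals (R : realType) (n m : nat) (K : instance R n m)
    (i : 'I_n) : R :=
  \int[lebesgue_measure]_(t in `[0, horizon K]) rate K i t.

Section LinearProgram.
Context (R : realType) (n m : nat) (K : instance R n m).
Implicit Types x y : 'I_n -> 'I_m -> R.

Definition lp_value x : R := \sum_i \sum_j x i j * usage K i j.

Definition lp_feasible x : Prop :=
  [/\ forall j, \sum_i x i j * usage K i j <= capacity K j,
      forall i, \sum_j x i j <= mean_arrivals K i
    & forall i j, 0 <= x i j].

Definition lp_optimal x : Prop :=
  lp_feasible x /\ forall y, lp_feasible y -> lp_value y <= lp_value x.

End LinearProgram.

(* A sample path is the list of the (arrival time, type) pairs of all customers
   in order of arrival.  In an offline assignment, [None] means rejected. *)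
Section Offline.
Context (R : realType) (n m : nat) (K : instance R n m).
Variable s : seq (R * 'I_n).

Definition ctype (k : 'I_(size s)) : 'I_n := (tnth (in_tuple s) k).2.

Definition allocated_to (a : {ffun 'I_(size s) -> option 'I_m}) (j : 'I_m) : R :=
  \sum_(k | a k == Some j) usage K (ctype k) j.

Definition offline_feasible (a : {ffun 'I_(size s) -> option 'I_m}) : bool :=
  [forall j, allocated_to a j <= capacity K j].

(* The default value 0 of the maximum is attained by rejecting everybody. *)
Definition OPT : R :=
  \big[Num.max/0]_(a | offline_feasible a) \sum_j allocated_to a j.

End Offline.

Section LargeOrSmall.
Context (R : realType) (n m : nat) (K : instance R n m).
Variable x : 'I_n -> 'I_m -> R.

Definition large (j : 'I_m) : {set 'I_n} :=
  [set i | capacity K j / 2 < usage K i j].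

Definition small (j : 'I_m) : {set 'I_n} := ~: large j.

Definition U_large (j : 'I_m) : R := \sum_(i in large j) x i j * usage K i j.

Definition U_small (j : 'I_m) : R := \sum_(i in small j) x i j * usage K i j.

Definition reserved (j : 'I_m) : {set 'I_n} :=
  if U_small j <= U_large j then large j else small j.

(* If [mean_arrivals K i = 0] the quotients are 0, so nothing is picked. *)
Definition route_prob (i : 'I_n) (o : option 'I_m) : R :=
  if o is Some j then x i j / mean_arrivals K i
  else 1 - \sum_j x i j / mean_arrivals K i.

(* [rho i k] is the outcome of the random routing of the (k+1)-st arriving
   customer of type i; [seen i] counts the type-i customers already processed
   and [rem j] is the remaining capacity of resource j.  The result is the
   amount of resources allocated to the customers of [s]. *)
Fixpoint LS_from (rho : 'I_n -> nat -> option 'I_m) (rem : 'I_m -> R)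
    (seen : 'I_n -> nat) (s : seq (R * 'I_n)) : R :=
  if s is (_, i) :: s' then
    let seen' := fun i' => if i' == i then (seen i).+1 else seen i' in
    if rho i (seen i) is Some j then
      if (usage K i j <= rem j) && (i \in reserved j) then
        usage K i j +
        LS_from rho (fun j' => if j' == j then rem j - usage K i j else rem j')
          seen' s'
      else LS_from rho rem seen' s'
    else LS_from rho rem seen' s'
  else 0.

Definition LS (rho : 'I_n -> nat -> option 'I_m) (s : seq (R * 'I_n)) : R :=
  LS_from rho (capacity K) (fun=> 0%N) s.

End LargeOrSmall.

(* Mutual independence of a (possibly infinite) family of sigma-algebras. *)
Definition mutually_independent (R : realType) (d : measure_display)
    (Omega : measurableType d) (P : probability Omega R) (S : eqType)
    (F : S -> set (set Omega)) : Prop :=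
  forall (J : seq S) (E : S -> set Omega), uniq J ->
    (forall a, a \in J -> F a (E a)) ->
    P (\bigcap_(a in [set` J]) E a) = (\prod_(a <- J) P (E a))%E.

(* Sigma-algebra generated by a family of functions with values in a countable
   set. *)
Definition generated_by (Omega A V : Type) (X : A -> Omega -> V) :
    set (set Omega) :=
  <<s [set E | exists a v, E = [set w | X a w = v]] >>.

(* Non-homogeneous Poisson process on [0, T] with rate [lam].  In the library
   [poisson_prob r k U] ignores its argument [k], and it is the Dirac mass at 0
   when [r = 0]. *)
Definition poisson_process (R : realType) (d : measure_display)
    (Omega : measurableType d) (P : probability Omega R) (T : R)
    (lam : R -> R) (N : R -> Omega -> nat) : Prop :=
  [/\ {ae P, forall w, N 0 w = 0%N},
      forall (s t : R) (U : set nat), 0 <= s -> s <= t -> t <= T ->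
        P [set w | U (N t w - N s w)%N] =
        poisson_prob (\int[lebesgue_measure]_(r in `]s, t]) lam r) 0 U
    & forall t : nat -> R, 0 <= t 0%N -> nondecreasing_seq t ->
        (forall l, t l <= T) ->
        mutually_independent P (fun l : nat =>
          generated_by (fun _ : unit => fun w => (N (t l.+1) w - N (t l) w)%N))].

Definition arrivals_upto (R : realType) (n : nat) (Omega : Type)
    (I : Omega -> seq (R * 'I_n)) (i : 'I_n) (t : R) (w : Omega) : nat :=
  count (fun c : R * 'I_n => (c.1 <= t) && (c.2 == i)) (I w).

(* [I] is the random sample path and [rho] the family of routing draws. *)
Record ls_model (R : realType) (n m : nat) (K : instance R n m)
    (x : 'I_n -> 'I_m -> R) (d : measure_display) (Omega : measurableType d)
    (P : probability Omega R) (I : Omega -> seq (R * 'I_n))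
    (rho : Omega -> 'I_n -> nat -> option 'I_m) : Prop := LSModel {
  arrivals_sorted : forall w, sorted <=%R (unzip1 (I w));
  arrivals_in_horizon : forall w c, c \in I w -> 0 <= c.1 <= horizon K;
  arrivals_measurable : forall (k : nat) (i : 'I_n) (B : set R), measurable B ->
    measurable [set w | exists2 t : R, B t & onth (I w) k = Some (t, i)];
  arrivals_poisson : forall i,
    poisson_process P (horizon K) (rate K i) (arrivals_upto I i);
  routing_measurable : forall i k o, measurable [set w | rho w i k = o];
  routing_law : forall i k o, P [set w | rho w i k = o] = (route_prob K x i o)%:E;
  (* The arrival processes of the different types and all the routing draws are
     mutually independent. *)
  model_independent : mutually_independent P
    (fun a : ('I_n + 'I_n * nat)%type =>
       match a with
       | inl i => generated_by (arrivals_upto I i)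
       | inr (i, k) => generated_by (fun _ : unit => fun w => rho w i k)
       end) }.

(* Main.v *)
Require Import Defs.
From HB Require Import structures.
From mathcomp Require Import all_boot all_order all_algebra.
From mathcomp Require Import all_classical all_reals all_analysis.
From mathcomp Require Import measurable_realfun ring lra.

Set Implicit Arguments.
Unset Strict Implicit.
Unset Printing Implicit Defensive.

Import Order.TTheory GRing.Theory Num.Theory.
Import numFieldNormedType.Exports.

Local Open Scope classical_set_scope.
Local Open Scope ring_scope.

(** Two estimates meet at the value of the linear program.

    Upper bound on the optimum ([expectation_OPT_le]): average, over the
    arrival counts, the number of type-i customers that an optimal offline plan
    sends to resource j.  The result is feasible for the linear program, since
    the counts have means [mean_arrivals], so the expected optimum is at most
    the optimal value [lp_value K x].

    Lower bound on the algorithm: resources do not interact once the routing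
    draws are made ([LS_from_routed]), so fix a resource j of capacity c and let
    l be the list of the usages of the customers routed to j whose type is
    reserved for j.  Whatever their order, the amount allocated on j is at least
      - c/2 * (1 - \prod_(u <- l) (1 - u / (c/2)))   if small types are reserved
        ([admitted_small]),
      - c/2 * (1 + \prod_(u <- l) (2u/c - 1)) - c * [l is empty]   if large
        types are reserved ([admitted_large]).
    These bounds are combinations of products over customers, and the
    expectation of such a product is explicit because the counts are Poisson and
    the draws independent: a factor phi_i per reserved type-i customer routed to
    j gives exp (- \sum_i x_ij (1 - phi_i)) ([request_prod_cvg]).  With
    U = \sum_i x_ij u_ij over the reserved types and mu = \sum_i x_ij, the small
    case yields c/2 * (1 - exp (-2U/c)).  The large case yields
    c/2 * (1 + Y^2 / E) - c * Y with Y = exp (-mu) and E = exp (-2U/c), which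
    exceeds c/2 * (1 - E) by c/2 * (Y - E)^2 / E.  So both cases give
    c/2 * (1 - exp (-2U/c)).  The reservation rule makes 2U at least
    U_large + U_small, which is at most c, and concavity of 1 - exp (-z) on
    [0, 1] ([exp_chord]) turns this into (1 - 1/e)/2 * (U_large + U_small)
    ([gain_cvg]).  Summing over j gives (1 - 1/e)/2 times [lp_value K x].

    These bounds depend on the sample path only through its total counts.  To
    keep all sums finite, expectations are computed on the event that every
    count is at most M, which splits into finitely many cells [cell] (counts and
    first M + 1 draws of each type prescribed), and M tends to infinity at the
    end.  The optimum and the reward of the algorithm are compared with step
    functions on the cells, by monotonicity of the integral of nonnegative
    functions. *)

(** * Expectations and step functions *)

Section Expectation.
Context (R : realType) (d : measure_display) (Omega : measurableType d)
  (P : probability Omega R).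

(** The integral of a nonnegative function is a supremum over the simple
    functions below it, hence monotone even on non-measurable functions. *)
Lemma le_expectation (f g : Omega -> R) :
  (forall w, 0 <= f w) -> (forall w, f w <= g w) -> ('E_P[f] <= 'E_P[g])%E.
Proof.
move=> f0 fg; rewrite !unlock !ge0_integralTE; last 2 first.
- by move=> w; rewrite lee_fin (le_trans (f0 w)).
- by move=> w; rewrite lee_fin.
apply: ereal_sup_le => _ [h hf <-]; exists h => // w.
by rewrite (le_trans (hf w))// lee_fin.
Qed.

Lemma expectation_step (A : finType) (B : A -> set Omega) (p a : A -> R) :
  (forall t, measurable (B t)) -> (forall t, P (B t) = (p t)%:E) ->
  (forall t, 0 <= a t) ->
  ('E_P[fun w => (\sum_t a t * \1_(B t) w)%R] = (\sum_t a t * p t)%R%:E)%E.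
Proof.
move=> mB PB a0; rewrite unlock.
under eq_integral do rewrite -sumEFin.
rewrite ge0_integral_sum//; last 2 first.
- move=> t; apply/measurable_EFinP; apply: measurable_funM => //.
- by move=> t w _; rewrite lee_fin mulr_ge0.
rewrite -sumEFin; apply: eq_bigr => t _.
under eq_integral do rewrite EFinM.
rewrite ge0_integralZl_EFin//; last exact/measurable_EFinP.
by rewrite EFinM -PB integral_indic// setIT.
Qed.

Lemma sum_indic_trivIset (A : finType) (B : A -> set Omega) (a : A -> R) t w :
  trivIset setT B -> B t w -> \sum_t a t * \1_(B t) w = a t.
Proof.
move=> tB Btw; rewrite (bigD1 t)//= big1 ?addr0; last first.
  move=> s st; rewrite indicE memNset ?mulr0// => Bsw; move/negP: st; apply.
  by apply/eqP/(tB s t I I); exists w.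
by rewrite indicE mem_set// mulr1.
Qed.

Lemma sum_indic_notin (A : finType) (B : A -> set Omega) (a : A -> R) w :
  (forall t, ~ B t w) -> \sum_t a t * \1_(B t) w = 0.
Proof.
by move=> nB; rewrite big1// => t _; rewrite indicE memNset ?mulr0.
Qed.

Lemma expectation_ge_step (A : finType) (B : A -> set Omega) (p a : A -> R)
    (f : Omega -> R) :
  (forall t, measurable (B t)) -> (forall t, P (B t) = (p t)%:E) ->
  trivIset setT B -> (forall w, 0 <= f w) ->
  (forall t w, B t w -> a t <= f w) ->
  ((\sum_t a t * p t)%:E <= 'E_P[f])%E.
Proof.
move=> mB PB tB f0 af; pose b t := Num.max (a t) 0.
have b0 t : 0 <= b t by rewrite le_max lexx orbT.
(* Since [f] is nonnegative, negative values of [a] can be raised to 0. *)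
apply: (@le_trans _ _ (\sum_t b t * p t)%:E).
  rewrite lee_fin; apply: ler_sum => t _; apply: ler_wpM2r.
    by rewrite -lee_fin -PB measure_ge0.
  by rewrite le_max lexx.
rewrite -(expectation_step mB PB b0).
apply: le_expectation => w.
  by apply: sumr_ge0 => t _; rewrite mulr_ge0.
have [[t Btw]|nB] := pselect (exists t, B t w).
  by rewrite (sum_indic_trivIset _ tB Btw) ge_max af// f0.
by rewrite sum_indic_notin// => t Btw; apply: nB; exists t.
Qed.

(** Off the union of the cells the only available bound is [c]; it is paid with
    the probability that the cells leave uncovered. *)
Lemma expectation_le_step (A : finType) (B : A -> set Omega) (p a : A -> R)
    (f : Omega -> R) (c : R) :
  (forall t, measurable (B t)) -> (forall t, P (B t) = (p t)%:E) ->
  trivIset setT B -> (forall t, 0 <= a t) -> (forall w, 0 <= f w <= c) ->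
  (forall t w, B t w -> f w <= a t) ->
  ('E_P[f] <= (\sum_t a t * p t + c * (1 - \sum_t p t))%:E)%E.
Proof.
move=> mB PB tB a0 f0c fa.
pose D o := if o is Some t then B t else ~` \bigcup_t B t.
have mU : measurable (\bigcup_t B t).
  by apply: fin_bigcup_measurable => //; exact: finite_finset.
have PD o : P (D o) =
    (if o is Some t then p t else 1 - \sum_t p t)%:E.
  case: o => [t|] //=; rewrite probability_setC// measure_fin_bigcup//;
    last exact: finite_finset.
  rewrite fsbig_finite/=; last exact: finite_finset.
  under eq_bigr do rewrite PB.
  rewrite sumEFin -EFinB; congr (1 - _)%:E.
  rewrite -big_enum /=; apply: perm_big; apply: uniq_perm.
  - exact: finmap.fset_uniq.
  - exact: enum_uniq.
  - move=> t; rewrite mem_enum in_fset_set; last exact: finite_finset.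
    by rewrite in_setT.
have mD o : measurable (D o).
  by case: o => [t|] //=; exact: measurableC.
(* The bounds on [f] only give [0 <= c] at a point, so Omega must be inhabited. *)
have c0 : 0 <= c.
  have /set0P[w _] : [set: Omega] != set0.
    apply/eqP => O0; have := @probability_setT _ _ _ P.
    by rewrite O0 measure0 => /eqP; rewrite eqe eq_sym oner_eq0.
  by case/andP: (f0c w) => /le_trans; apply.
have cD o : 0 <= if o is Some t then a t else c by case: o.
have -> : \sum_t a t * p t + c * (1 - \sum_t p t) =
  \sum_(o : option A) (if o is Some t then a t else c) *
    (if o is Some t then p t else 1 - \sum_t p t).
  rewrite [RHS](bigD1 None)//= addrC; congr +%R.
  rewrite (reindex_omap Some (fun x => x)); last by case.
  by apply: eq_bigl => t /=; rewrite eqxx.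
rewrite -(expectation_step mD PD cD).
apply: le_expectation => w; first by case/andP: (f0c w).
have tD : trivIset setT D.
  move=> [s|] [t|] _ _ //= [v [/= h1 h2]].
  - by congr Some; apply: (tB s t I I); exists v.
  - by exfalso; apply: h2; exists s.
  - by exfalso; apply: h1; exists t.
have [[t Btw]|nB] := pselect (exists t, B t w).
  by rewrite (@sum_indic_trivIset _ D _ (Some t) w) ?fa.
rewrite (@sum_indic_trivIset _ D _ None w)//.
  by case/andP: (f0c w).
move=> /=; apply: contra_not nB.
by move=> -[t _ Bt]; exists t.
Qed.

End Expectation.

(** * Greedy admission on one resource *)

Section Admission.
Context (R : realFieldType).
Implicit Types (b c r u : R) (l : seq R).

(** What the algorithm allocates on a single resource of remaining capacity
    [r], where [l] lists the usages of the reserved customers routed to it. *)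
Fixpoint admitted r l : R :=
  if l is u :: l' then
    if u <= r then u + admitted (r - u) l' else admitted r l'
  else 0.

Lemma admitted_ge0 r l : all (fun u => 0 <= u) l -> 0 <= admitted r l.
Proof.
elim: l r => //= u l IH r /andP[u0 l0]; case: ifP => _; last exact: IH.
by rewrite addr_ge0// IH.
Qed.

Lemma prod_itv01 (A : eqType) (s : seq A) (F : A -> R) :
  (forall a, a \in s -> 0 <= F a <= 1) -> 0 <= \prod_(a <- s) F a <= 1.
Proof.
move=> F01; rewrite big_seq.
apply: (big_ind (fun y => 0 <= y <= 1)) => [|y z /andP[y0 y1] /andP[z0 z1]|//].
  by rewrite ler01 lexx.
by rewrite mulr_ge0// mulr_ile1.
Qed.

(** With requests of size at most [b], a request is refused only when less
    than [b] remains.  While at least [b] remains, serving [u] gains [u] and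
    lowers [r - b] by [u], and the claim propagates because [r <= 2 * b]; once
    less than [b] remains, the bound is nonpositive. *)
Lemma admitted_small b r l : 0 < b -> r <= 2 * b ->
  (forall u, u \in l -> 0 <= u <= b) ->
  (r - b) * (1 - \prod_(u <- l) (1 - u / b)) <= admitted r l.
Proof.
move=> b0; elim: l r => [|u l IH] r r2b ub.
  by rewrite big_nil subrr mulr0.
have /andP[u0 u_le] : 0 <= u <= b by apply: ub; rewrite mem_head.
have ubl v : v \in l -> 0 <= v <= b by move=> vl; apply: ub; rewrite in_cons vl orbT.
have frac v : 0 <= v <= b -> 0 <= 1 - v / b <= 1.
  move=> /andP[v0 vb]; rewrite subr_ge0 ler_pdivrMr// mul1r vb/=.
  by rewrite lerBlDr lerDl divr_ge0// ltW.
have /andP[Q0 Q1] : 0 <= \prod_(v <- l) (1 - v / b) <= 1.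
  by apply: prod_itv01 => v /ubl /frac.
have [rb|br] := ltP r b.
  apply: le_trans (_ : 0 <= _).
    rewrite mulr_le0_ge0 ?subr_le0 ?(ltW rb)// subr_ge0.
    have /prod_itv01/andP[] // : forall v, v \in u :: l -> 0 <= 1 - v / b <= 1.
    by move=> v /ub /frac.
  by apply: admitted_ge0; apply/allP => v /ub /andP[].
rewrite big_cons /= (le_trans u_le br).
have := IH (r - u); set Q := \prod_(v <- l) _ => /(_ _ ubl) IHu.
have {IHu} : (r - u - b) * (1 - Q) <= admitted (r - u) l by apply: IHu; lra.
set X := admitted _ _ => IHu.
have -> : (r - b) * (1 - (1 - u / b) * Q) =
    u + (r - u - b) * (1 - Q) - u * Q * (2 * b - r) / b.
  by field; rewrite gt_eqF.
have : 0 <= u * Q * (2 * b - r) / b.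
  by rewrite divr_ge0 ?(ltW b0)// !mulr_ge0// subr_ge0.
lra.
Qed.

(** The first request [u] is always served, and each factor lies in [0, 1], so
    the product is at most [2 * u / c - 1] and the bound at most [u].  The last
    term, 1 exactly when [l] is empty, cancels the bound on the empty list. *)
Lemma admitted_large c l : 0 < c ->
  (forall u, u \in l -> c / 2 < u <= c) ->
  c / 2 * (1 + \prod_(u <- l) (2 * u / c - 1)) - c * \prod_(u <- l) 0
    <= admitted c l.
Proof.
move=> c0; case: l => [|u l] ub; first by rewrite !big_nil /=; lra.
have /andP[cu uc] : c / 2 < u <= c by apply: ub; rewrite mem_head.
have frac v : v \in u :: l -> 0 <= 2 * v / c - 1 <= 1.
  move=> /ub /andP[cv vc].
  by rewrite subr_ge0 ler_pdivlMr// lerBlDr ler_pdivrMr//; apply/andP; split; lra.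
have /andP[Q0 Q1] : 0 <= \prod_(v <- l) (2 * v / c - 1) <= 1.
  by apply: prod_itv01 => v vl; apply: frac; rewrite in_cons vl orbT.
have /andP[f0 _] := frac u (mem_head _ _).
rewrite !big_cons mul0r mulr0 subr0 /= uc.
apply: (@le_trans _ _ u).
  have : (2 * u / c - 1) * \prod_(v <- l) (2 * v / c - 1) <= 2 * u / c - 1.
    by rewrite ler_piMr.
  set Q := (X in X <= _) => QX.
  have uE : c / 2 * (1 + (2 * u / c - 1)) = u by field; rewrite gt_eqF.
  by rewrite -[leRHS]uE ler_pM2l ?lerD2l// divr_gt0.
rewrite lerDl admitted_ge0//; apply/allP => v vl.
have /andP[+ _] : c / 2 < v <= c by apply: ub; rewrite in_cons vl orbT.
by move=> cv; lra.
Qed.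

End Admission.

(** * Splitting the run of the algorithm by resource *)

Section Routing.
Context (R : realType) (n m : nat) (K : instance R n m).
Variable x : 'I_n -> 'I_m -> R.
Implicit Types (rho : 'I_n -> nat -> option 'I_m) (s : seq (R * 'I_n)).

(** All that the algorithm learns about the customers. *)
Fixpoint routed rho (seen : 'I_n -> nat) s : seq ('I_n * option 'I_m) :=
  if s is (_, i) :: s' then
    (i, rho i (seen i)) ::
    routed rho (fun i' => if i' == i then (seen i).+1 else seen i') s'
  else [::].

Definition requests (j : 'I_m) : pred ('I_n * option 'I_m) :=
  fun q => (q.2 == Some j) && (q.1 \in reserved K x j).

Definition demands (j : 'I_m) (l : seq ('I_n * option 'I_m)) : seq R :=
  [seq usage K q.1 j | q <- l & requests j q].

(** A customer only touches the resource it is routed to, so the run is a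
    family of separate greedy admissions, one per resource. *)
Lemma LS_from_routed rho rem seen s :
  LS_from K x rho rem seen s =
  \sum_j admitted (rem j) (demands j (routed rho seen s)).
Proof.
elim: s rem seen => [|[t i] s IH] rem seen /=.
  by rewrite big1.
rewrite /demands /requests /=; set seen' := fun _ => _.
case: (rho i (seen i)) => [j|]; last by rewrite IH; apply: eq_bigr.
rewrite !IH {IH}; set l := routed _ _ _.
rewrite [RHS](bigD1 j)//= eqxx /=.
have rest r' : (forall j', j' != j -> r' j' = rem j') ->
    \sum_(k < m) admitted (r' k) (demands k l) =
    admitted (r' j) (demands j l) +
    \sum_(k < m | k != j) admitted (rem k)
       [seq usage K q.1 k | q <- if (Some j == Some k) && (i \in reserved K x k)
            then (i, Some j) :: [seq q <- l | requests k q]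
            else [seq q <- l | requests k q]].
  move=> r'E; rewrite (bigD1 j)//=; congr +%R; apply: eq_bigr => k kj.
  by rewrite r'E//; have /negbTE-> : Some j != Some k by rewrite eq_sym.
case: ifP => [/andP[ur ->] /=|].
  rewrite ur rest ?eqxx ?addrA// => k /negbTE-> //.
move=> /negbT; rewrite negb_and => nadm; rewrite rest//; congr +%R.
case: ifP => //= irj; move: nadm; rewrite irj orbF => /negbTE -> //.
Qed.

(** The k-th customer of a type uses the k-th draw of that type, so a product
    over customers depends on the path only through the arrival counts. *)
Lemma prod_routed (F : 'I_n -> option 'I_m -> R) rho seen s :
  \prod_(q <- routed rho seen s) F q.1 q.2 =
  \prod_i \prod_(k < count (fun a => a.2 == i) s) F i (rho i (seen i + k)%N).
Proof.
elim: s seen => [|[t i] s IH] seen /=.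
  by rewrite big_nil big1// => i _; rewrite big_ord0.
rewrite big_cons IH /= [RHS](bigD1 i)//= [in LHS](bigD1 i)//= !eqxx mulrA.
congr *%R.
  rewrite add1n big_ord_recl addn0; congr *%R.
  by apply: eq_bigr => k _; rewrite addSnnS.
apply: eq_bigr => i' /negbTE i'i.
by rewrite [i == i']eq_sym i'i add0n.
Qed.

End Routing.

(** * Poisson masses *)

(** At [r = 0] this is the point mass at 0, the law for a type that never
    arrives, whereas [poisson_pmf] is constantly 1 there. *)
Definition poisson_mass (R : realType) (r : R) (k : nat) : R :=
  r ^+ k / k`!%:R * expR (- r).

Lemma poisson_mass_ge0 (R : realType) (r : R) k :
  0 <= r -> 0 <= poisson_mass r k.
Proof. by move=> r0; rewrite mulr_ge0 ?expR_ge0// divr_ge0// exprn_ge0. Qed.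

Lemma poisson_prob_set1 (R : realType) (r : R) k : 0 <= r ->
  poisson_prob r 0 [set k] = (poisson_mass r k)%:E.
Proof.
rewrite le_eqVlt /poisson_prob /poisson_mass => /predU1P[<-|r0].
  rewrite ltxx oppr0 expR0 mulr1 expr0n /= diracE.
  have -> : (0%N \in [set k]) = (k == 0%N).
    by apply/idP/eqP; rewrite inE => ->.
  by case: eqP => [->|_]; rewrite ?fact0 ?divr1 ?mul0r.
rewrite r0 esum_set1; first by rewrite /poisson_pmf r0.
by rewrite lee_fin poisson_pmf_ge0.
Qed.

Section PoissonSums.
Context (R : realType).
Implicit Types (r a : R).

(** The probability generating function of the Poisson law. *)
Lemma poisson_generating_cvg r a :
  (fun M => \sum_(k < M.+1) poisson_mass r k * a ^+ k) @ \oo -->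
  expR (- (r * (1 - a))).
Proof.
have -> : expR (- (r * (1 - a))) = expR (- r) * expR (r * a).
  by rewrite -expRD; congr expR; ring.
have -> : (fun M => \sum_(k < M.+1) poisson_mass r k * a ^+ k) =
    (fun M => expR (- r) * series (exp_coeff (r * a)) M.+1).
  apply/funext => M; rewrite /series /= big_mkord mulr_sumr.
  apply: eq_bigr => k _; rewrite /poisson_mass /exp_coeff /= exprMn; ring.
apply: cvgM; first exact: cvg_cst.
rewrite (cvg_shiftS (series (exp_coeff (r * a)))).
exact: is_cvg_series_exp_coeff.
Qed.

Lemma sum_poisson_mass_cvg r :
  (fun M => \sum_(k < M.+1) poisson_mass r k) @ \oo --> (1 : R).
Proof.
have -> : (fun M => \sum_(k < M.+1) poisson_mass r k) =
    (fun M => \sum_(k < M.+1) poisson_mass r k * 1 ^+ k).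
  by apply/funext => M; apply: eq_bigr => k _; rewrite expr1n mulr1.
by have := @poisson_generating_cvg r 1; rewrite subrr mulr0 oppr0 expR0.
Qed.

Lemma sum_poisson_mass_le1 r M : 0 <= r -> \sum_(k < M) poisson_mass r k <= 1.
Proof.
move=> r0; pose u M' := \sum_(k < M'.+1) poisson_mass r k.
have u1 : u @ \oo --> (1 : R) := @sum_poisson_mass_cvg r.
have u_nd : nondecreasing_seq u.
  by apply/nondecreasing_seqP => k; rewrite [leRHS]big_ord_recr lerDl poisson_mass_ge0.
have := nondecreasing_cvgn_le u_nd (cvgP _ u1) M.
rewrite (cvg_lim _ u1)//; apply: le_trans.
by rewrite /u big_ord_recr lerDl poisson_mass_ge0.
Qed.

Lemma sum_poisson_mean_le r M : 0 <= r ->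
  \sum_(k < M.+1) k%:R * poisson_mass r k <= r.
Proof.
move=> r0; rewrite big_ord_recl mul0r add0r.
apply: (@le_trans _ _ (r * \sum_(k < M) poisson_mass r k)); last first.
  by rewrite ler_piMr// sum_poisson_mass_le1.
rewrite mulr_sumr; apply: ler_sum => k _; rewrite le_eqVlt; apply/orP; left.
apply/eqP; rewrite /poisson_mass /= /bump /= add1n factS exprS natrM.
have k1 : (k%:R + 1 : R) != 0 by rewrite natr1 pnatr_eq0.
have kf : (k`!%:R : R) != 0 by rewrite pnatr_eq0 -lt0n fact_gt0.
by rewrite -natr1; field; rewrite k1 kf.
Qed.

End PoissonSums.

(** * Law of the arrival counts and routing draws *)

(** A scenario prescribes all arrival counts, each at most M, and the first
    M + 1 routing draws of each type; draws beyond the count of their type are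
    included so that the set of scenarios is a plain finite product. *)
Local Notation scenario n m M :=
  ({ffun 'I_n -> 'I_M.+1} * {ffun 'I_n * 'I_M.+1 -> option 'I_m})%type.

Section ModelLaw.
Context (R : realType) (n m : nat) (K : instance R n m)
  (x : 'I_n -> 'I_m -> R) (d : measure_display) (Omega : measurableType d)
  (P : probability Omega R) (I : Omega -> seq (R * 'I_n))
  (rho : Omega -> 'I_n -> nat -> option 'I_m)
  (model : ls_model K x P I rho).

(** Tags determine the counts at time [t] and at the horizon.  They live in a
    finite type, so the sequence of tags is a countably valued observable, all
    of whose events are measurable. *)
Definition tags (t : R) (s : seq (R * 'I_n)) : seq ('I_n * bool) :=
  [seq (a.2, a.1 <= t) | a <- s].

Lemma tag_measurable t k q :
  measurable [set w | onth (tags t (I w)) k = Some q].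
Proof.
case: q => i b.
have [B [mB BE]] : exists B : set R, measurable B /\ forall s, B s <-> (s <= t) = b.
  exists [set s | (s <= t) = b]; split=> //; case: b.
    rewrite (_ : mkset _ = [set` `]-oo, t]])//; apply/seteqP;
      split=> s /=; by rewrite in_itv.
  rewrite (_ : mkset _ = [set` `]t, +oo[])//; apply/seteqP; split=> s /=;
    by rewrite in_itv/= andbT ltNge; first [move=> -> | move/negbTE].
have := arrivals_measurable model k i mB.
congr measurable; apply/seteqP; split => w /=.
  by move=> [s /BE sb]; rewrite /tags onth_map => -> /=; rewrite sb.
rewrite /tags onth_map; case: onth => //= -[s i'] /= [<- sb]; exists s => //.
exact/BE.
Qed.

Lemma tags_event_measurable t (Q : set (seq ('I_n * bool))) :
  measurable [set w | Q (tags t (I w))].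
Proof.
pose A (s : seq ('I_n * bool)) : set Omega := [set w | tags t (I w) = s].
have mA s : measurable (A s).
  have -> : A s = \bigcap_k [set w | onth (tags t (I w)) k = onth s k].
    apply/seteqP; split=> [w ws k _ /=|w ws]; first by rewrite ws.
    by apply: eq_from_onth => k; exact: ws.
  apply: bigcapT_measurable => k; case: (onth s k) => [q|].
    exact: tag_measurable.
  have -> : [set w | onth (tags t (I w)) k = None] =
      ~` \bigcup_q [set w | onth (tags t (I w)) k = Some q].
    apply/seteqP; split=> w /=; first by move=> wk [q _ /=]; rewrite wk.
    by case E: onth => [q|]// nq; exfalso; apply: nq; exists q.
  apply: measurableC; apply: fin_bigcup_measurable; first exact: finite_finset.
  by move=> q _; exact: tag_measurable.
have -> : [set w | Q (tags t (I w))] = \bigcup_s (A s `&` [set w | Q s]).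
  apply/seteqP; split=> w /=; first by exists (tags t (I w)).
  by move=> [s _ [<-]].
apply: countable_bigcupT_measurable; first exact: countableP.
move=> s; have [Qs|nQs] := pselect (Q s).
  by rewrite (_ : mkset _ = setT) ?setIT//; apply/seteqP; split.
by rewrite (_ : mkset _ = set0) ?setI0//; apply/seteqP; split.
Qed.

Definition arrival_count (w : Omega) (i : 'I_n) : nat :=
  count (fun a => a.2 == i) (I w).

Lemma arrivals_upto_tags i t w :
  arrivals_upto I i t w = count_mem (i, true) (tags t (I w)).
Proof.
rewrite /tags count_map; apply: eq_count => a /=.
by rewrite xpair_eqE eqb_id andbC.
Qed.

Lemma arrivals_upto_horizon i w :
  arrivals_upto I i (horizon K) w = arrival_count w i.
Proof.
apply: eq_in_count => a aI.
by have /andP[_ ->] := arrivals_in_horizon model aI.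
Qed.

Lemma arrival_count_tags t w i :
  arrival_count w i = count (fun q => q.1 == i) (tags t (I w)).
Proof. by rewrite /tags count_map; apply: eq_count. Qed.

Lemma arrival_count_measurable i k : measurable [set w | arrival_count w i = k].
Proof.
have := tags_event_measurable 0 [set s | count (fun q => q.1 == i) s = k].
congr measurable; apply/seteqP; split=> w /=; by rewrite (arrival_count_tags 0).
Qed.

Lemma mean_arrivals_ge0 i : 0 <= mean_arrivals K i.
Proof.
apply: Rintegral_ge0 => t /=; rewrite in_itv /=; exact: rate_ge0.
Qed.

(** The increment of the process over the whole horizon has the Poisson law,
    and it equals the final count up to the null event that the process does
    not start at 0. *)
Lemma arrival_count_law i k :
  P [set w | arrival_count w i = k] = (poisson_mass (mean_arrivals K i) k)%:E.
Proof.
have [[N [mN PN0 N0]] incr _] := arrivals_poisson model i.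
have T0 := horizon_ge0 K.
have := incr 0 (horizon K) [set k] (lexx _) T0 (lexx _).
rewrite Rintegral_itv_obnd_cbnd; last first.
  apply: integrableS (rate_integrable K i) => //.
  exact: subset_itv_oc_cc.
rewrite poisson_prob_set1 ?mean_arrivals_ge0// => <-.
set A := mkset _; set B := mkset _.
have mA : measurable A by exact: arrival_count_measurable.
have mB : measurable B.
  have := tags_event_measurable 0
    [set s | (count (fun q => q.1 == i) s - count_mem (i, true) s)%N = k].
  congr measurable; apply/seteqP; split=> w;
    by rewrite /B /= arrivals_upto_horizon arrivals_upto_tags (arrival_count_tags 0).
have AB : A `|` N = B `|` N.
  apply/seteqP; split=> w [] hw; try (by right).
  - have [Nw|nNw] := pselect (N w); [by right|left].
    have w0 : arrivals_upto I i 0 w = 0%N by apply: contrapT => h; apply: nNw; apply: N0.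
    by rewrite /B /= w0 subn0 arrivals_upto_horizon.
  - have [Nw|nNw] := pselect (N w); [by right|left].
    have w0 : arrivals_upto I i 0 w = 0%N by apply: contrapT => h; apply: nNw; apply: N0.
    by move: hw; rewrite /B /= w0 subn0 arrivals_upto_horizon.
by rewrite -(measureU0 mA mN PN0) AB (measureU0 mB mN PN0).
Qed.

Definition cell (M : nat) (t : scenario n m M) : set Omega :=
  [set w | (forall i, arrival_count w i = t.1 i) /\
           (forall q : 'I_n * 'I_M.+1, rho w q.1 q.2 = t.2 q)].

Lemma cell_trivIset M : trivIset setT (@cell M).
Proof.
move=> [v1 r1] [v2 r2] _ _ [w [[/= h1 h2] [/= h3 h4]]].
congr (_, _); apply/ffunP => q; last exact: etrans (esym (h2 q)) (h4 q).
by apply: val_inj; exact: etrans (esym (h1 q)) (h3 q).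
Qed.

Lemma cell_measurable M t : measurable (@cell M t).
Proof.
have -> : cell t = (\bigcap_i [set w | arrival_count w i = t.1 i]) `&`
    (\bigcap_(q : 'I_n * 'I_M.+1) [set w | rho w q.1 q.2 = t.2 q]).
  apply/seteqP; split=> w [h1 h2]; split=> q.
  - by move=> _; exact: h1.
  - by move=> _; exact: h2.
  - exact: h1.
  - exact: h2.
apply: measurableI; apply: fin_bigcap_measurable; rewrite ?finite_finset//.
- by move=> i _; exact: arrival_count_measurable.
- by move=> q _; exact: routing_measurable model _ _ _.
Qed.

Definition cell_prob (M : nat) (t : scenario n m M) : R :=
  (\prod_i poisson_mass (mean_arrivals K i) (t.1 i)) *
  \prod_(q : 'I_n * 'I_M.+1) route_prob K x q.1 (t.2 q).

(** A cell prescribes finitely many of the mutually independent objects of the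
    model: one event for each arrival process and one for each routing draw. *)
Lemma cell_law M t : P (@cell M t) = (cell_prob t)%:E.
Proof.
pose J : seq ('I_n + 'I_n * nat) := map inl (enum 'I_n) ++
  [seq inr (q.1, val q.2) | q <- enum {: 'I_n * 'I_M.+1}].
pose E (a : 'I_n + 'I_n * nat) : set Omega := match a with
  | inl i => [set w | arrival_count w i = t.1 i]
  | inr (i, k) => [set w | rho w i k = t.2 (i, inord k)] end.
have uJ : uniq J.
  have inlI : injective (@inl 'I_n ('I_n * nat)) by move=> i i' [].
  have inrI : injective (fun q : 'I_n * 'I_M.+1 =>
      inr (q.1, val q.2) : 'I_n + 'I_n * nat).
    by move=> q q' [q1 /val_inj q2]; apply/eqP/andP; rewrite q1 q2.
  rewrite cat_uniq (map_inj_uniq inlI) (map_inj_uniq inrI) !enum_uniq /=.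
  by rewrite andbT; apply/hasPn => _ /mapP[q _ ->]; apply/mapP => -[].
have -> : cell t = \bigcap_(a in [set` J]) E a.
  apply/seteqP; split=> w.
    move=> [h1 h2] a /=; rewrite mem_cat => /orP[/mapP[i _ ->]//|/mapP[q _ ->]] /=.
    by rewrite inord_val h2 -surjective_pairing.
  move=> h; split=> [i|[i k]].
    by apply: (h (inl i)); rewrite /= mem_cat map_f// mem_enum.
  have := h (inr (i, val k)); rewrite /= inord_val; apply.
  by rewrite mem_cat; apply/orP; right; apply/mapP; exists (i, k); rewrite ?mem_enum.
rewrite (model_independent model uJ); last first.
  move=> a _; case: a => [i|[i k]]; apply: sub_sigma_algebra.
    exists (horizon K), (t.1 i); apply/seteqP; split=> w /=;
      by rewrite arrivals_upto_horizon.
  by exists tt, (t.2 (i, inord k)).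
rewrite big_cat (big_map inl) (big_map (fun q : _ * _ => inr (q.1, val q.2))).
rewrite !big_enum /= /cell_prob EFinM -!prodEFin.
congr (_ * _)%E; apply: eq_bigr => q _; first exact: arrival_count_law.
by rewrite inord_val (routing_law model) -surjective_pairing.
Qed.

End ModelLaw.

(** * Product expectations over scenarios *)

Section CellSums.
Context (R : realType) (n m : nat) (K : instance R n m)
  (x : 'I_n -> 'I_m -> R).

Lemma sum_option (G : option 'I_m -> R) :
  \sum_o G o = G None + \sum_j G (Some j).
Proof.
rewrite (bigD1 None)//=; congr +%R.
rewrite (reindex_omap Some (fun o => o)); last by case.
by apply: eq_bigl => j /=; rewrite eqxx.
Qed.

Lemma sum_route_prob i : \sum_o route_prob K x i o = 1.
Proof. by rewrite sum_option /= subrK. Qed.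

(** The generating function of the truncated model.  Each type contributes a
    weight [G] of its count and a factor [F] for each of the draws it uses; the
    unused draws sum to 1, and distributivity separates types and draws. *)
Lemma sum_cell_prob M (G : 'I_n -> nat -> R) (F : 'I_n -> option 'I_m -> R) :
  \sum_(t : scenario n m M)
    (\prod_i (G i (t.1 i) * \prod_(k < t.1 i) F i (t.2 (i, inord k)))) *
    cell_prob K x t =
  \prod_i \sum_(k < M.+1) G i k * poisson_mass (mean_arrivals K i) k *
    (\sum_o route_prob K x i o * F i o) ^+ k.
Proof.
rewrite -(pair_bigA _ (fun (v : {ffun 'I_n -> 'I_M.+1})
  (r : {ffun 'I_n * 'I_M.+1 -> option 'I_m}) => (\prod_i (G i (v i) * \prod_(k < v i)
  F i (r (i, inord k)))) * cell_prob K x (v, r))) /=.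
rewrite (bigA_distr_bigA (fun i (k : 'I_M.+1) => G i k * _ * _)) /=.
apply: eq_bigr => v _; rewrite /cell_prob /=.
pose h (q : 'I_n * 'I_M.+1) o :=
  route_prob K x q.1 o * (if (q.2 < v q.1)%N then F q.1 o else 1).
transitivity ((\prod_i (G i (v i) * poisson_mass (mean_arrivals K i) (v i))) *
    \sum_(r : {ffun 'I_n * 'I_M.+1 -> option 'I_m}) \prod_q h q (r q)).
  rewrite mulr_sumr; apply: eq_bigr => r _.
  rewrite /h !big_split /=.
  have -> : \prod_i \prod_(k < v i) F i (r (i, inord k)) =
      \prod_(q : 'I_n * 'I_M.+1) (if (q.2 < v q.1)%N then F q.1 (r q) else 1).
    transitivity (\prod_(q : 'I_n * 'I_M.+1)
        (if (q.2 < v q.1)%N then F q.1 (r (q.1, q.2)) else 1)); last first.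
      by apply: eq_bigr => -[].
    rewrite -(pair_bigA _ (fun i (k : 'I_M.+1) =>
      if (k < v i)%N then F i (r (i, k)) else 1)) /=.
    apply: eq_bigr => i _.
    rewrite (big_ord_widen M.+1 (fun k => F i (r (i, inord k)))); last first.
      exact/ltnW/ltn_ord.
    by rewrite big_mkcond; apply: eq_bigr => k _; rewrite inord_val.
  by rewrite mulrACA [X in _ * X]mulrC; ring.
rewrite -(bigA_distr_bigA h) !big_split /=; congr (_ * _).
pose a i := \sum_o route_prob K x i o * F i o.
transitivity (\prod_(q : 'I_n * 'I_M.+1) (if (q.2 < v q.1)%N then a q.1 else 1)).
  apply: eq_bigr => q _; rewrite /h; case: ifP => _ //.
  by under eq_bigr do rewrite mulr1; rewrite sum_route_prob.
rewrite -(pair_bigA _ (fun i (k : 'I_M.+1) => if (k < v i)%N then a i else 1)) /=.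
apply: eq_bigr => i _; rewrite -big_mkcond /=.
rewrite -(big_ord_widen M.+1 (fun=> a i)); last exact/ltnW/ltn_ord.
by rewrite prodr_const card_ord.
Qed.

End CellSums.

(** * Offline plans *)

Section OfflineBound.
Context (R : realType) (n m : nat) (K : instance R n m).
Section Plans.
Context (M : nat).
Implicit Types (v : {ffun 'I_n -> 'I_M.+1})
  (y : {ffun 'I_n * 'I_m -> 'I_M.+1}).

(** A plan [y] serves [y (i, j)] customers of type [i] with resource [j]; it
    forgets which customers these are, so that plans for given counts form a
    finite type. *)
Definition plan_value y : R := \sum_i \sum_j (y (i, j))%:R * usage K i j.

Definition plan_feasible v y : bool :=
  [forall j, \sum_i (y (i, j))%:R * usage K i j <= capacity K j] &&
  [forall i, (\sum_j y (i, j) <= v i)%N].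

Lemma plan0_feasible v : plan_feasible v [ffun=> ord0].
Proof.
apply/andP; split; apply/forallP => q.
  by rewrite big1 ?ltW ?capacity_gt0// => i _; rewrite ffunE mul0r.
by rewrite big1// => j _; rewrite ffunE.
Qed.

Definition best_plan v : {ffun 'I_n * 'I_m -> 'I_M.+1} :=
  [arg max_(y > [ffun=> ord0] | plan_feasible v y) plan_value y]%O.

Lemma best_plan_feasible v : plan_feasible v (best_plan v).
Proof. by rewrite /best_plan; case: arg_maxP => //; exact: plan0_feasible. Qed.

Lemma best_plan_max v y :
  plan_feasible v y -> plan_value y <= plan_value (best_plan v).
Proof.
rewrite /best_plan; case: arg_maxP => [|y' _ max_y' /max_y' //].
exact: plan0_feasible.
Qed.

Lemma plan_value_ge0 y : 0 <= plan_value y.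
Proof.
apply: sumr_ge0 => i _; apply: sumr_ge0 => j _; rewrite mulr_ge0//.
by case/andP: (usage_bounds K i j).
Qed.

(** Counting the customers of each type that an assignment sends to each
    resource turns it into a feasible plan of the same value. *)
Lemma OPT_le_best_plan v (s : seq (R * 'I_n)) :
  (forall i, count (fun a => a.2 == i) s = v i) ->
  OPT K s <= plan_value (best_plan v).
Proof.
move=> sv; apply: bigmax_le => [|a /forallP a_ok]; first exact: plan_value_ge0.
pose N i j := #|[pred k | (a k == Some j) && (ctype k == i)]|.
have cnt i : #|[pred k : 'I_(size s) | ctype k == i]| = v i.
  rewrite -sv -sum1_card -sum1_count [RHS]big_tnth.
  by apply: eq_bigl => k; rewrite unfold_in.
have sumN i : (\sum_j N i j <= v i)%N.
  rewrite -cnt -sum1_card (bigID (fun k => a k == None)) /=.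
  apply: leq_trans (leq_addl _ _).
  rewrite (partition_big a (fun o => o != None)) /=; last by move=> k /andP[].
  rewrite (reindex_omap Some (fun o => o)); last by case.
  rewrite [leqRHS](_ : _ = \sum_j
      \sum_(k in [pred k | ctype k == i] | a k == Some j) 1)%N.
    apply: leq_sum => j _; rewrite /N -sum1_card; apply/eq_leq/eq_bigl => k.
    by rewrite !inE andbC.
  apply: eq_big => [j|j _]; first by rewrite eqxx.
  by apply: eq_bigl => k; case: (a k) => [j'|]; rewrite ?andbT ?andbF.
have Nlt i j : (N i j < M.+1)%N.
  rewrite ltnS (leq_trans _ (leq_ord (v i)))//.
  by apply: leq_trans (sumN i); rewrite (bigD1 j) //= leq_addr.
pose y : {ffun 'I_n * 'I_m -> 'I_M.+1} := [ffun q => inord (N q.1 q.2)].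
have yE i j : y (i, j) = N i j :> nat by rewrite ffunE inordK.
have allocE j : allocated_to K a j = \sum_i (y (i, j))%:R * usage K i j.
  rewrite /allocated_to (partition_big (@ctype _ _ _) xpredT)//=.
  apply: eq_bigr => i _; rewrite yE.
  rewrite (eq_bigr (fun=> usage K i j)) => [|k /andP[_ /eqP->]//].
  by rewrite sumr_const mulr_natl.
under eq_bigr do rewrite allocE.
rewrite exchange_big; apply: best_plan_max; apply/andP; split; apply/forallP => q.
  by rewrite -allocE.
by under eq_bigr do rewrite yE.
Qed.

End Plans.

Lemma OPT_ge0 (s : seq (R * 'I_n)) : 0 <= OPT K s.
Proof. exact: bigmax_ge_id. Qed.

Lemma OPT_le_capacity (s : seq (R * 'I_n)) : OPT K s <= \sum_j capacity K j.
Proof.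
apply: bigmax_le => [|a /forallP a_ok].
  by apply: sumr_ge0 => j _; rewrite ltW// capacity_gt0.
by apply: ler_sum => j _.
Qed.

End OfflineBound.

(** * Passing to the limit *)

Section Limits.
Context (R : realType).

Lemma lee_lim_EFin (e : \bar R) (u : nat -> R) (l : R) :
  (forall M, e <= (u M)%:E)%E -> u @ \oo --> l -> (e <= l%:E)%E.
Proof.
move=> eu ul0; have ul : EFin (u M) @[M --> \oo] --> l%:E.
  by apply: cvg_EFin => //; exact: nearW.
have <- := cvg_lim _ ul => //.
by apply: lime_ge; [exact: cvgP ul|exact: nearW].
Qed.

Lemma lim_EFin_lee (e : \bar R) (u : nat -> R) (l : R) :
  (forall M, (u M)%:E <= e)%E -> u @ \oo --> l -> (l%:E <= e)%E.
Proof.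
move=> eu ul0; have ul : EFin (u M) @[M --> \oo] --> l%:E.
  by apply: cvg_EFin => //; exact: nearW.
have <- := cvg_lim _ ul => //.
by apply: lime_le; [exact: cvgP ul|exact: nearW].
Qed.

(** The concave function 1 - exp (- z) lies above its chord over [0, 1]. *)
Lemma exp_chord (z : R) : 0 <= z <= 1 ->
  (1 - (expR 1)^-1) * z <= 1 - expR (- z).
Proof.
move=> /andP[z0 z1]; have := convex_expR (Itv01 z0 z1) (-1) 0.
rewrite !convRE /= /unstable.onem mulrN1 mulr0 addr0 expR0 -expRN; lra.
Qed.
End Limits.

(** * The optimum is bounded by the linear program *)

Section OptimumBound.
Context (R : realType) (n m : nat) (K : instance R n m)
  (x : 'I_n -> 'I_m -> R) (d : measure_display) (Omega : measurableType d)
  (P : probability Omega R) (I : Omega -> seq (R * 'I_n))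
  (rho : Omega -> 'I_n -> nat -> option 'I_m)
  (model : ls_model K x P I rho).

Lemma cell_prob_ge0 M (t : scenario n m M) : 0 <= cell_prob K x t.
Proof. by rewrite -lee_fin -(cell_law model t) measure_ge0. Qed.

Lemma sum_cell_prob1 M :
  \sum_(t : scenario n m M)
    cell_prob K x t =
  \prod_i \sum_(k < M.+1) poisson_mass (mean_arrivals K i) k.
Proof.
have := sum_cell_prob K x M (fun _ _ => 1) (fun _ _ => 1).
rewrite (eq_bigr (cell_prob K x (M:=M))) => [|t _]; last first.
  by rewrite big1 ?mul1r// => i _; rewrite mul1r big1.
move=> ->; apply: eq_bigr => i _; apply: eq_bigr => k _.
under eq_bigr do rewrite mulr1.
by rewrite sum_route_prob expr1n mul1r mulr1.
Qed.

(** Weighting the scenarios by a count gives the mean of a Poisson variable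
    restricted to an event. *)
Lemma mean_count_le M i :
  \sum_(t : scenario n m M)
    (t.1 i)%:R * cell_prob K x t <= mean_arrivals K i.
Proof.
have := sum_cell_prob K x M (fun l k => if l == i then k%:R else 1) (fun _ _ => 1).
rewrite (eq_bigr (fun t : scenario n m M => (t.1 i)%:R * cell_prob K x t))
  => [|t _]; last first.
  rewrite (bigD1 i)//= eqxx [X in _ * X * _]big1 ?mulr1; last first.
    by move=> l /negbTE ->; rewrite mul1r big1.
  by rewrite [X in _ * X * _]big1// mulr1.
move=> ->; rewrite (bigD1 i)//= eqxx -[leRHS]mulr1.
have one l k : (\sum_o route_prob K x l o * 1) ^+ k = 1 :> R.
  by under eq_bigr do rewrite mulr1; rewrite sum_route_prob expr1n.
have L0 l := mean_arrivals_ge0 K l.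
apply: ler_pM.
- by apply: sumr_ge0 => k _; rewrite one mulr1 mulr_ge0// poisson_mass_ge0.
- apply: prodr_ge0 => l _; apply: sumr_ge0 => k _.
  by rewrite one mulr1 mulr_ge0 ?poisson_mass_ge0//; case: ifP.
- by under eq_bigr do rewrite one mulr1; exact: sum_poisson_mean_le.
- apply: prodr_ile1 => l li.
  have -> : \sum_(k < M.+1) (if l == i then k%:R else 1) *
      poisson_mass (mean_arrivals K l) k * (\sum_o route_prob K x l o * 1) ^+ k =
      \sum_(k < M.+1) poisson_mass (mean_arrivals K l) k.
    by apply: eq_bigr => k _; rewrite one mulr1 (negbTE li) mul1r.
  rewrite sum_poisson_mass_le1// andbT sumr_ge0// => k _.
  exact: poisson_mass_ge0.
Qed.

(** The average of the best plans over the scenarios is feasible for the linear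
    program, hence worth at most as much as [x].  The event that some count exceeds M costs
    at most the total capacity times a probability that vanishes with M. *)
Lemma expectation_OPT_le : lp_optimal K x ->
  ('E_P[fun w => OPT K (I w)] <= (lp_value K x)%:E)%E.
Proof.
move=> [_ x_opt].
pose C := \sum_j capacity K j.
pose u M := lp_value K x +
  C * (1 - \prod_i \sum_(k < M.+1) poisson_mass (mean_arrivals K i) k).
apply: (@lee_lim_EFin _ _ u) => [M|]; last first.
  rewrite -[X in _ --> X]addr0; apply: cvgD; first exact: cvg_cst.
  rewrite -[X in _ --> X](mulr0 C); apply: cvgM; first exact: cvg_cst.
  rewrite -[X in _ --> X](subrr 1); apply: cvgB; first exact: cvg_cst.
  rewrite -[X in _ --> X](@big1 _ 1 *%R _ (index_enum 'I_n) xpredT (fun=> 1))//.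
  apply: cvg_big => [|i _]; first exact: mul_continuous.
  exact: sum_poisson_mass_cvg.
apply: (@le_trans _ _ (\sum_(t : scenario n m M)
    plan_value K (best_plan K t.1) * cell_prob K x t +
    C * (1 - \sum_(t : scenario n m M) cell_prob K x t))%:E).
  apply: (expectation_le_step (@cell_measurable _ _ _ _ _ _ _ _ _ _ model M)
    (cell_law model (M:=M))).
  - exact: cell_trivIset.
  - by move=> t; exact: plan_value_ge0.
  - by move=> w; rewrite OPT_ge0 OPT_le_capacity.
  - by move=> t w [tw _]; apply: OPT_le_best_plan.
rewrite lee_fin sum_cell_prob1 lerD2r.
pose y i j := \sum_(t : scenario n m M)
  (best_plan K t.1 (i, j))%:R * cell_prob K x t.
apply: le_trans (x_opt y _); last split.
- rewrite le_eqVlt; apply/orP; left; apply/eqP.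
  rewrite /lp_value /y; under eq_bigr do rewrite /plan_value mulr_suml.
  rewrite exchange_big; apply: eq_bigr => i _.
  under eq_bigr do rewrite mulr_suml.
  rewrite exchange_big; apply: eq_bigr => j _ /=.
  by rewrite mulr_suml; apply: eq_bigr => t _; rewrite mulrAC.
- move=> j; rewrite /y; under eq_bigr do rewrite mulr_suml.
  rewrite exchange_big /=.
  apply: (@le_trans _ _ (\sum_(t : scenario n m M) capacity K j * cell_prob K x t)).
    apply: ler_sum => t _.
    under eq_bigr do rewrite mulrAC; rewrite -mulr_suml.
    rewrite ler_wpM2r ?cell_prob_ge0//.
    by have /andP[/forallP/(_ j)] := best_plan_feasible K t.1.
  rewrite -mulr_sumr sum_cell_prob1 ler_piMr ?(ltW (capacity_gt0 K j))//.
  apply: prodr_ile1 => i _; rewrite sum_poisson_mass_le1 ?mean_arrivals_ge0//.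
  by rewrite andbT sumr_ge0// => k _; rewrite poisson_mass_ge0// mean_arrivals_ge0.
- move=> i; rewrite exchange_big /=; apply: le_trans (mean_count_le M i).
  apply: ler_sum => t _; rewrite -mulr_suml ler_wpM2r ?cell_prob_ge0//.
  rewrite -natr_sum ler_nat.
  by have /andP[_ /forallP/(_ i)] := best_plan_feasible K t.1.
- by move=> i j; apply: sumr_ge0 => t _; rewrite mulr_ge0// cell_prob_ge0.
Qed.

End OptimumBound.

(** * Expected reward of one resource *)

Lemma U_large_small (R : realType) (n m : nat) (K : instance R n m)
    (x : 'I_n -> 'I_m -> R) j :
  U_large K x j + U_small K x j = \sum_i x i j * usage K i j.
Proof.
rewrite [RHS](bigID (mem (large K j))) /=; congr +%R; apply: eq_bigl => i.
by rewrite finset.in_setC.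
Qed.

Section PerResource.
Context (R : realType) (n m : nat) (K : instance R n m)
  (x : 'I_n -> 'I_m -> R) (x_lp : lp_feasible K x) (j : 'I_m).

Definition request_factor (phi : 'I_n -> R) (i : 'I_n) (o : option 'I_m) : R :=
  if requests K x j (i, o) then phi i else 1.

Definition request_prod (phi : 'I_n -> R) (M : nat) (t : scenario n m M) : R :=
  \prod_i \prod_(k < t.1 i) request_factor phi i (t.2 (i, inord k)).

Lemma request_prod1 M (t : scenario n m M) : request_prod (fun=> 1) t = 1.
Proof.
rewrite /request_prod big1// => i _; rewrite big1// => k _.
by rewrite /request_factor; case: ifP.
Qed.

(** If type [i] has mean 0, the quotient is 0, and so is [x i j] by
    feasibility. *)
Lemma mean_route i : mean_arrivals K i * (x i j / mean_arrivals K i) = x i j.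
Proof.
case: x_lp => _ rows x0; have [L0|L0] := eqVneq (mean_arrivals K i) 0.
  rewrite L0 mul0r; apply/esym/le_anti; rewrite x0 andbT -L0.
  by apply: le_trans (rows i); rewrite (bigD1 j)//= lerDl sumr_ge0.
by rewrite mulrC divfK.
Qed.

Lemma mean_request_factor phi i :
  \sum_o route_prob K x i o * request_factor phi i o =
  1 - (if i \in reserved K x j then x i j / mean_arrivals K i * (1 - phi i) else 0).
Proof.
transitivity (\sum_o (route_prob K x i o -
    (if requests K x j (i, o) then route_prob K x i o * (1 - phi i) else 0))).
  by apply: eq_bigr => o _; rewrite /request_factor; case: ifP => _; ring.
rewrite sumrB sum_route_prob; congr (1 - _).
rewrite sum_option /requests /= add0r (bigD1 j)//= eqxx /= big1 ?addr0//.
by move=> k /negbTE kj; rewrite (inj_eq (@Some_inj _)) kj.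
Qed.

(** Thinning: the reserved requests of type [i] on resource [j] behave like a
    Poisson variable of mean [x i j], and different types are independent. *)
Lemma request_prod_cvg phi :
  (fun M => \sum_(t : scenario n m M) request_prod phi t * cell_prob K x t)
    @ \oo --> expR (- \sum_(i in reserved K x j) x i j * (1 - phi i)).
Proof.
have -> : (fun M => \sum_(t : scenario n m M) request_prod phi t * cell_prob K x t) =
    (fun M => \prod_i \sum_(k < M.+1) poisson_mass (mean_arrivals K i) k *
      (\sum_o route_prob K x i o * request_factor phi i o) ^+ k).
  apply/funext => M; have := sum_cell_prob K x M (fun _ _ => 1) (request_factor phi).
  rewrite (eq_bigr (fun t : scenario n m M =>
    request_prod phi t * cell_prob K x t)) => [->|t _]; last first.
    by under [X in X * _]eq_bigr do rewrite mul1r.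
  by apply: eq_bigr => i _; apply: eq_bigr => k _; rewrite mul1r.
rewrite -sumrN big_mkcond expR_sum.
apply: cvg_big => [|i _]; first exact: mul_continuous.
have -> : (if i \in reserved K x j then - (x i j * (1 - phi i)) else 0) =
    - (mean_arrivals K i * (1 - \sum_o route_prob K x i o * request_factor phi i o)).
  rewrite mean_request_factor; case: ifP => _; last by rewrite subr0 subrr mulr0 oppr0.
  by congr (- _); rewrite -[in LHS]mean_route; ring.
exact: poisson_generating_cvg.
Qed.

Lemma prod_demands (psi : R -> R) (rho : 'I_n -> nat -> option 'I_m) s M
    (t : scenario n m M) :
  (forall i, count (fun a : R * 'I_n => a.2 == i) s = t.1 i) ->
  (forall q : 'I_n * 'I_M.+1, rho q.1 q.2 = t.2 q) ->
  \prod_(u <- demands K x j (routed rho (fun=> 0%N) s)) psi u =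
  request_prod (fun i => psi (usage K i j)) t.
Proof.
move=> st rt; rewrite /demands big_map big_filter big_mkcond /=.
rewrite (eq_bigr (fun q => request_factor (fun i => psi (usage K i j)) q.1 q.2)); last first.
  by move=> [i o].
rewrite prod_routed; apply: eq_bigr => i _; rewrite st.
apply: eq_bigr => k _; congr request_factor; rewrite add0n -rt /= inordK//.
exact: ltn_trans (ltn_ord k) (ltn_ord _).
Qed.

Local Notation c := (capacity K j).

(** The bounds of [admitted_large] and [admitted_small] (with [b = c / 2]) on a
    scenario; the order of the requests, unknown there, has disappeared. *)
Definition gain M (t : scenario n m M) : R :=
  if U_small K x j <= U_large K x j then
    c / 2 * (1 + request_prod (fun i => 2 * usage K i j / c - 1) t)
    - c * request_prod (fun=> 0) t
  else (2 * (c / 2) - c / 2) * (1 - request_prod (fun i => 1 - usage K i j / (c / 2)) t).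

Lemma gain_le_admitted (rho : 'I_n -> nat -> option 'I_m) s M (t : scenario n m M) :
  (forall i, count (fun a : R * 'I_n => a.2 == i) s = t.1 i) ->
  (forall q : 'I_n * 'I_M.+1, rho q.1 q.2 = t.2 q) ->
  gain t <= admitted c (demands K x j (routed rho (fun=> 0%N) s)).
Proof.
move=> st rt; have c0 := capacity_gt0 K j.
have dem u : u \in demands K x j (routed rho (fun=> 0%N) s) ->
    exists2 i, i \in reserved K x j & u = usage K i j.
  move=> /mapP[[i o]]; rewrite mem_filter => /andP[/andP[_ ir] _] ->.
  by exists i.
have usage_le i := usage_bounds K i j.
rewrite /gain; move: dem; rewrite /reserved; case: ifP => _ dem.
  rewrite -(prod_demands (fun u => 2 * u / c - 1) st rt).
  rewrite -(prod_demands (fun=> 0) st rt).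
  apply: admitted_large => // u /dem[i]; rewrite inE => iL ->.
  by rewrite iL; case/andP: (usage_le i).
rewrite -(prod_demands (fun u => 1 - u / (c / 2)) st rt).
have -> : admitted c (demands K x j (routed rho (fun=> 0%N) s)) =
  admitted (2 * (c / 2)) (demands K x j (routed rho (fun=> 0%N) s)).
  by congr admitted; field.
apply: admitted_small => [||u /dem[i]]; rewrite ?divr_gt0//.
by rewrite !inE -leNgt => iS ->; rewrite iS; case/andP: (usage_le i) => ->.
Qed.

(** Both reservation rules lead to c/2 * (1 - E): for small types this is the
    limit itself, for large types the limit exceeds it by a square. *)
Lemma gain_cvg : exists2 l,
  (fun M => \sum_(t : scenario n m M) gain t * cell_prob K x t) @ \oo --> l &
  2^-1 * (1 - (expR 1)^-1) * (U_large K x j + U_small K x j) <= l.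
Proof.
pose S phi M := \sum_(t : scenario n m M) request_prod phi t * cell_prob K x t.
pose U := \sum_(i in reserved K x j) x i j * usage K i j.
have c0 := capacity_gt0 K j.
have [cols _ x0] := x_lp.
have usage0 i : 0 <= usage K i j by case/andP: (usage_bounds K i j).
have UL0 : 0 <= U_large K x j by apply: sumr_ge0 => i _; rewrite mulr_ge0.
have US0 : 0 <= U_small K x j by apply: sumr_ge0 => i _; rewrite mulr_ge0.
have ULS : U_large K x j + U_small K x j <= c by rewrite U_large_small.
have U2 : U_large K x j + U_small K x j <= 2 * U.
  rewrite /U /reserved; case: ifP => [h|/negbT]; rewrite -/(U_large K x j).
    lra.
  by rewrite -ltNge -/(U_small K x j) => h; lra.
pose E := expR (- (2 * U / c)).
have main : 2^-1 * (1 - (expR 1)^-1) * (U_large K x j + U_small K x j) <=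
    c / 2 * (1 - E).
  pose z := (U_large K x j + U_small K x j) / c.
  have z01 : 0 <= z <= 1 by rewrite divr_ge0 ?addr_ge0 ?(ltW c0)//= ler_pdivrMr// mul1r.
  have := exp_chord z01; have zU : E <= expR (- z).
    by rewrite ler_expR lerN2 ler_pM2r ?invr_gt0.
  have -> : U_large K x j + U_small K x j = z * c by rewrite divfK ?gt_eqF.
  move=> h; have : c / 2 * ((1 - (expR 1)^-1) * z) <= c / 2 * (1 - E).
    by rewrite ler_wpM2l ?divr_ge0 ?(ltW c0)//; lra.
  by apply: le_trans; rewrite le_eqVlt; apply/orP; left; apply/eqP; ring.
have S1 : S (fun=> 1) @ \oo --> (1 : R).
  have := @request_prod_cvg (fun=> 1).
  rewrite [X in expR (- X)]big1 ?oppr0 ?expR0; first exact.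
  by move=> i _; rewrite subrr mulr0.
rewrite /gain; case: (U_small K x j <= U_large K x j).
  pose mu := \sum_(i in reserved K x j) x i j.
  pose Y := expR (- mu).
  (* Y is the probability of no request, Y^2 / E the expected product. *)
  exists (c / 2 * (1 + Y ^+ 2 / E) - c * Y); last first.
    apply: le_trans main _; rewrite -subr_ge0.
    have -> : c / 2 * (1 + Y ^+ 2 / E) - c * Y - c / 2 * (1 - E) =
      c / 2 * ((Y - E) ^+ 2 / E) by field; rewrite gt_eqF ?expR_gt0.
    by rewrite mulr_ge0 ?divr_ge0 ?sqr_ge0 ?expR_ge0 ?(ltW c0).
  have -> : (fun M => \sum_(t : scenario n m M)
      (c / 2 * (1 + request_prod (fun i => 2 * usage K i j / c - 1) t) -
       c * request_prod (fun=> 0) t) * cell_prob K x t) =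
    (fun M => c / 2 * (S (fun=> 1) M + S (fun i => 2 * usage K i j / c - 1) M) -
      c * S (fun=> 0) M).
    apply/funext => M; rewrite /S -big_split /= !mulr_sumr -sumrB.
    by apply: eq_bigr => t _; rewrite request_prod1; ring.
  apply: cvgB; apply: cvgM; try exact: cvg_cst.
    apply: cvgD.
      exact: S1.
    have -> : Y ^+ 2 / E = expR (- \sum_(i in reserved K x j)
        x i j * (1 - (2 * usage K i j / c - 1))).
      rewrite /Y /E -expRM_natl -expRN -expRD; congr expR.
      have -> : \sum_(i in reserved K x j) x i j * (1 - (2 * usage K i j / c - 1)) =
          2 * mu - 2 * U / c.
        rewrite /mu /U !mulr_sumr mulr_suml -sumrB.
        by apply: eq_bigr => i _; ring.
      ring.
    exact: request_prod_cvg.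
  have -> : Y = expR (- \sum_(i in reserved K x j) x i j * (1 - 0)).
    by rewrite /Y; congr (expR (- _)); apply: eq_bigr => i _; rewrite subr0 mulr1.
  exact: request_prod_cvg.
exists (c / 2 * (1 - E)) => //.
have -> : (fun M => \sum_(t : scenario n m M)
    ((2 * (c / 2) - c / 2) * (1 - request_prod (fun i => 1 - usage K i j / (c / 2)) t)) *
    cell_prob K x t) =
  (fun M => c / 2 * (S (fun=> 1) M - S (fun i => 1 - usage K i j / (c / 2)) M)).
  apply/funext => M; rewrite /S -sumrB /= !mulr_sumr.
  by apply: eq_bigr => t _; rewrite request_prod1; field.
apply: cvgM; first exact: cvg_cst.
apply: cvgB.
  exact: S1.
have -> : E = expR (- \sum_(i in reserved K x j)
    x i j * (1 - (1 - usage K i j / (c / 2)))).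
  rewrite /E /U; congr (expR (- _)); rewrite mulr_sumr mulr_suml.
  by apply: eq_bigr => i _; field; rewrite gt_eqF.
exact: request_prod_cvg.
Qed.

End PerResource.

(** * Competitive ratio *)

Lemma lp_value_split (R : realType) (n m : nat) (K : instance R n m)
    (x : 'I_n -> 'I_m -> R) :
  lp_value K x = \sum_j (U_large K x j + U_small K x j).
Proof.
by rewrite /lp_value exchange_big; apply: eq_bigr => j _; rewrite U_large_small.
Qed.

Lemma LS_ge0 (R : realType) (n m : nat) (K : instance R n m)
    (x : 'I_n -> 'I_m -> R) rho s : 0 <= LS K x rho s.
Proof.
rewrite /LS LS_from_routed; apply: sumr_ge0 => j _; apply: admitted_ge0.
by apply/allP => _ /mapP[q _ ->]; case/andP: (usage_bounds K q.1 j).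
Qed.

Theorem theorem1 (R : realType) (n m : nat) (K : instance R n m)
    (x : 'I_n -> 'I_m -> R) (x_opt : lp_optimal K x)
    (d : measure_display) (Omega : measurableType d) (P : probability Omega R)
    (I : Omega -> seq (R * 'I_n))
    (rho : Omega -> 'I_n -> nat -> option 'I_m)
    (model : ls_model K x P I rho) :
  ((2^-1 * (1 - (expR 1)^-1))%:E * 'E_P[fun w => OPT K (I w)] <=
   'E_P[fun w => LS K x (rho w) (I w)])%E.
Proof.
have ratio0 : 0 <= 2^-1 * (1 - (expR 1)^-1) :> R.
  by rewrite mulr_ge0// subr_ge0 invf_le1 ?expR_gt0// ltW// expR_gt1.
apply: (@le_trans _ _ (2^-1 * (1 - (expR 1)^-1) * lp_value K x)%:E).
  rewrite [leRHS]EFinM lee_wpmul2l ?lee_fin//; exact: expectation_OPT_le model x_opt.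
have [x_lp _] := x_opt.
have /choice[l l_lim] : forall j, exists l,
    (fun M => \sum_(t : scenario n m M) gain K x j t * cell_prob K x t) @ \oo --> l /\
    2^-1 * (1 - (expR 1)^-1) * (U_large K x j + U_small K x j) <= l.
  by move=> j; have [l ? ?] := gain_cvg x_lp j; exists l.
apply: (@le_trans _ _ (\sum_j l j)%:E).
  by rewrite lee_fin lp_value_split mulr_sumr; apply: ler_sum => j _; case: (l_lim j).
pose V M := \sum_j \sum_(t : scenario n m M) gain K x j t * cell_prob K x t.
apply: (@lim_EFin_lee _ _ V) => [M|]; last first.
  apply: cvg_big => [|j _]; first exact: add_continuous.
  by case: (l_lim j).
rewrite /V exchange_big /=; under eq_bigr do rewrite -mulr_suml.
apply: (expectation_ge_step (@cell_measurable _ _ _ _ _ _ _ _ _ _ model M)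
    (cell_law model (M:=M))).
- exact: cell_trivIset.
- by move=> w; exact: LS_ge0.
- move=> t w [wt rt]; rewrite /LS LS_from_routed; apply: ler_sum => j _.
  exact: gain_le_admitted.
Qed.
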